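(* Let $(a,b)$ be an admissible pair. Then $$\left\lfloor\frac{b-1}{2}\right\rfloor\le c_{a,b}\le b-1,$$ and, for all $n=1,2,\dots$, $$\left\lfloor\frac{b-1}{2}\right\rfloor n+\left\lceil\frac{b-1}{2}\right\rceil\le p_{a,b}(n)\le (b-1)n.$$ Moreover, these bounds are sharp: for every squarefree integer $b\ge 5$, the upper bounds (in both chains of inequalities) are attained for $a=b+1$, while the lower bounds (in both) are attained for $a=2$.
   Context: For an integer $b\ge 3$ and a real $x>0$, the leading digit $D_b(x)\in\{1,2,\dots,b-1\}$ of $x$ in base $b$ is defined by: $D_b(x)=d$ if and only if $d\cdot b^j\le x<(d+1)b^j$ for some $j\in\mathbb{Z}$. For real $a>0$, the leading digit sequence is $S_{a,b}=\{D_b(a^n)\}_{n=1}^\infty$. Its (block) complexity function is $$p_{a,b}(n)=\#\{(D_b(a^m),D_b(a^{m+1}),\dots,D_b(a^{m+n-1})): m=1,2,\dots\},$$ the number of distinct blocks of $n$ consecutive terms occurring in $S_{a,b}$. A pair $(a,b)$ is called admissible if (i) $b$ is a squarefree integer $\ge 5$, and (ii) $a$ is a positive rational number that is not an integral power of $b$ (i.e., $a\ne b^h$ for every $h\in\mathbb{Z}$). For an admissible pair $(a,b)$, write uniquely $a=\frac{r}{s}b^k$ with $k\in\mathbb{Z}$, $r,s\in\mathbb{N}$, $\gcd(r,s)=1$, $1<\frac rs<b$, and set $$c_{a,b}=b-1-\left\lfloor\frac{b-1}{r}\right\rfloor-\left\lfloor\frac{\gcd(b,r)-1}{s}\right\rfloor.$$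 *)

(* Defs.v *)
From mathcomp Require Import all_boot all_order all_algebra finmap.
From mathcomp Require Import boolp classical_sets functions cardinality reals.

Set Implicit Arguments.
Unset Strict Implicit.
Unset Printing Implicit Defensive.

Import Order.TTheory GRing.Theory Num.Theory.

Local Open Scope ring_scope.
Local Open Scope classical_set_scope.

Section LeadingDigit.
Context {R : realType}.
Implicit Types (a x : R) (b d n r s : nat) (j k : int).

(* The restriction 0 < d < b is needed for uniqueness: in base 10, the inequality
   with j = 0 also holds for x = 12 and d = 12. *)
Definition is_lead_digit b x d : Prop :=
  (0 < d < b)%N /\ exists j, d%:R * b%:R ^ j <= x < d.+1%:R * b%:R ^ j.

(* The value is meaningful only for 2 <= b and 0 < x; see [lead_digitP]. *)
Definition lead_digit b x : nat := xget 0%N [set d | is_lead_digit b x d].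

(* [block a b n m] is the block of length n starting at the m-th term of the
   leading digit sequence of a, whose terms are indexed from 1. *)
Definition block a b n (m : nat) : seq nat :=
  [seq lead_digit b (a ^+ i) | i <- iota m n].

Definition blocks a b n : set (seq nat) :=
  block a b n @` [set m | (1 <= m)%N].

(* [fset_set] is only meaningful for finite sets; see [finite_blocks]. *)
Definition complexity a b n : nat := #|` fset_set (blocks a b n)|.

Definition squarefree b : Prop := forall d, (d ^ 2 %| b)%N -> d = 1%N.

Definition admissible a b : Prop :=
  [/\ squarefree b, (5 <= b)%N, 0 < a, rational a
    & forall h : int, a <> b%:R ^ h].

Definition is_reduced_form a b (rs : nat * nat) : Prop :=
  [/\ coprime rs.1 rs.2, 1 < rs.1%:R / rs.2%:R :> R,
      rs.1%:R / rs.2%:R < b%:R :> R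
    & exists k, a = rs.1%:R / rs.2%:R * b%:R ^ k].

(* The pair (r, s); it exists and is unique for admissible (a, b), see
   [reduced_form_exists] and [reduced_form_unique]. *)
Definition reduced_form a b : nat * nat := xget (1, 1)%N (is_reduced_form a b).

Definition cab a b : int :=
  let: (r, s) := reduced_form a b in
  b%:Z - 1 - ((b%:Z - 1) %/ r%:Z)%Z - (((gcdn b r)%:Z - 1) %/ s%:Z)%Z.

Lemma exprz_bracket b x : (1 < b)%N -> 0 < x ->
  exists j, b%:R ^ j <= x < b%:R ^ (j + 1).
Proof.
move=> b1 x0; have b0 : 0 < b%:R :> R by rewrite ltr0n ltnW.
have big (y : R) : 0 <= y -> exists n : nat, y < b%:R ^+ n.
  move=> y0; exists (Num.bound y); apply: lt_trans (archi_boundP y0) _.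
  by rewrite -natrX ltr_nat ltn_expl.
have [m xm] : exists m : nat, x^-1 < b%:R ^+ m by apply: big; rewrite invr_ge0 ltW.
have bm0 : 0 < b%:R ^+ m :> R by rewrite exprn_gt0.
have exn : exists n : nat, x * b%:R ^+ m < b%:R ^+ n.
  by apply: big; rewrite mulr_ge0// ltW.
case: (ex_minnP exn) => -[|n] yn minn.
  move: yn; rewrite expr0 => yn; exfalso; move: xm.
  rewrite -(ltr_pM2l x0) mulfV ?gt_eqF// => /lt_trans /(_ yn).
  by rewrite ltxx.
exists (n%:Z - m%:Z); have bn0 : b%:R != 0 :> R by rewrite gt_eqF.
have -> : n%:Z - m%:Z + 1 = n.+1%:Z - m%:Z by rewrite addrAC -addn1 PoszD.
rewrite !expfzDr// -!invr_expz ler_pdivrMr// ltr_pdivlMr// yn andbT.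
by rewrite leNgt; apply/negP => /minn; rewrite ltnn.
Qed.

Lemma exprz_bracket_unique b x j k : (1 < b)%N ->
  b%:R ^ j <= x < b%:R ^ (j + 1) -> b%:R ^ k <= x < b%:R ^ (k + 1) -> j = k.
Proof.
move=> b1 /andP[j1 j2] /andP[k1 k2].
have b1R : 1 < b%:R :> R by rewrite ltr1n.
have := le_lt_trans j1 k2; rewrite ltr_eXz2l// ltzD1 => jk.
have := le_lt_trans k1 j2; rewrite ltr_eXz2l// ltzD1 => kj.
by apply/eqP; rewrite eq_le jk.
Qed.

Lemma is_lead_digit_exists b x : (1 < b)%N -> 0 < x -> exists d, is_lead_digit b x d.
Proof.
move=> b1 x0; have [j /andP[jx xj]] := exprz_bracket b1 x0.
have b0 : 0 < b%:R :> R by rewrite ltr0n ltnW.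
have bj0 : 0 < b%:R ^ j :> R by rewrite exprz_gt0.
have y0 : 0 <= x / b%:R ^ j by rewrite divr_ge0 ?ltW.
have /andP[t1 t2] := truncn_itv y0; exists (Num.truncn (x / b%:R ^ j)); split.
  apply/andP; split.
    rewrite -ltnS -(ltr_nat R); apply: le_lt_trans t2.
    by rewrite ler_pdivlMr// mul1r.
  rewrite -(ltr_nat R); apply: (le_lt_trans t1).
  by rewrite ltr_pdivrMr// mulrC -[X in _ * X]expr1z -expfzDr// gt_eqF.
by exists j; rewrite -ler_pdivlMr// -ltr_pdivrMr// t1.
Qed.

Lemma is_lead_digit_unique b x d d' :
  is_lead_digit b x d -> is_lead_digit b x d' -> d = d'.
Proof.
move=> [/andP[d0 db] [j /andP[jd dj]]] [/andP[d'0 d'b] [k /andP[kd dk]]].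
have b1 : (1 < b)%N by exact: leq_ltn_trans db.
have b0 : 0 < b%:R :> R by rewrite ltr0n ltnW.
have pw i e : (0 < e < b)%N -> e%:R * b%:R ^ i <= x -> x < e.+1%:R * b%:R ^ i ->
    b%:R ^ i <= x < b%:R ^ (i + 1).
  move=> /andP[e0 eb] ex xe; have bi0 : 0 < b%:R ^ i :> R by rewrite exprz_gt0.
  apply/andP; split; first by apply: le_trans ex; rewrite ler_peMl ?ler1n// ltW.
  apply: (lt_le_trans xe); rewrite expfzDr ?gt_eqF// expr1z mulrC.
  by rewrite ler_pM2l// ler_nat.
have djk : j = k.
  by apply: exprz_bracket_unique b1 (pw _ d _ jd dj) (pw _ d' _ kd dk);
    apply/andP; split.
subst k; have bj0 : 0 < b%:R ^ j :> R by rewrite exprz_gt0.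
have := le_lt_trans jd dk; rewrite ltr_pM2r// ltr_nat ltnS => dd'.
have := le_lt_trans kd dj; rewrite ltr_pM2r// ltr_nat ltnS => d'd.
by apply/eqP; rewrite eqn_leq dd'.
Qed.

Lemma lead_digitP b x d : (1 < b)%N -> 0 < x ->
  lead_digit b x = d <-> is_lead_digit b x d.
Proof.
move=> b1 x0; have := xgetPex 0%N (is_lead_digit_exists b1 x0).
rewrite /= -/(lead_digit b x) => Dx; split=> [<-//|].
exact: is_lead_digit_unique.
Qed.

Lemma finite_blocks b a n : (1 < b)%N -> 0 < a -> finite_set (blocks a b n).
Proof.
move=> b1 a0.
apply: (@sub_finite_set _ _ (range (fun w : n.-tuple 'I_b => [seq val i | i <- w]))).
  move=> _ [m _ <-].
  have Db i : (lead_digit b (a ^+ i) < b)%N.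
    have /(lead_digitP _ b1)[] // := erefl (lead_digit b (a ^+ i)).
      by rewrite exprn_gt0.
    by move=> /andP[].
  have sz : size [seq Ordinal (Db i) | i <- iota m n] == n by rewrite size_map size_iota.
  by exists (Tuple sz) => //=; rewrite -map_comp; apply: eq_map.
exact: finite_image.
Qed.

Lemma reduced_form_exists a b : admissible a b -> exists rs, is_reduced_form a b rs.
Proof.
case=> _ b5 a0 [q _ qa] ab; subst a.
have b1 : (1 < b)%N by exact: leq_trans b5.
have b0 : b%:R != 0 :> R by rewrite pnatr_eq0 -lt0n ltnW.
have [j /andP[jx xj]] := exprz_bracket b1 a0.
have bj0 : 0 < b%:R ^ j :> R by rewrite exprz_gt0// ltr0n ltnW.
pose y : rat := q / b%:R ^ j.
have yE : ratr y = ratr q / b%:R ^ j :> R.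
  by rewrite /y fmorph_div fmorphXz rmorph_nat.
have y1 : 1 < ratr y :> R.
  rewrite yE ltr_pdivlMr// mul1r lt_neqAle jx andbT.
  by apply/eqP => /esym; exact: ab.
have yb : ratr y < b%:R :> R.
  by rewrite yE ltr_pdivrMr// mulrC -[X in _ * X]expr1z -expfzDr.
have y0 : 0 < y by rewrite -(ltr0q R) (lt_trans _ y1).
have ydiv : (`|numq y|%N%:R / `|denq y|%N%:R : R) = ratr y.
  by rewrite /ratr !natr_absz ger0_norm ?numq_ge0 ?ltW// ger0_norm// denq_ge0.
exists (`|numq y|%N, `|denq y|%N); split; rewrite /= ?ydiv//.
  exact: coprime_num_den.
by exists j; rewrite yE divfK// gt_eqF.
Qed.

Lemma reduced_form_unique a b rs rs' : (1 < b)%N ->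
  is_reduced_form a b rs -> is_reduced_form a b rs' -> rs = rs'.
Proof.
case: rs rs' => [r s] [r' s'] b1 [/= rs yl yr [j ja]] [/= rs' yl' yr' [k ka]].
have b0 : 0 < b%:R :> R by rewrite ltr0n ltnW.
have pw (y : R) i : 1 < y -> y < b%:R -> a = y * b%:R ^ i ->
    b%:R ^ i <= a < b%:R ^ (i + 1).
  move=> y1 y2 ->; have bi0 : 0 < b%:R ^ i :> R by rewrite exprz_gt0.
  by rewrite ler_peMl ?(ltW y1) ?ltW//= expfzDr ?gt_eqF// expr1z mulrC ltr_pM2l.
have jk := exprz_bracket_unique b1 (pw _ _ yl yr ja) (pw _ _ yl' yr' ka).
subst k; have bj0 : b%:R ^ j != 0 :> R by rewrite gt_eqF// exprz_gt0.
have pos (u v : nat) : 1 < u%:R / v%:R :> R -> (0 < v)%N.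
  by case: v => // ; rewrite invr0 mulr0 ltr10.
have s0 := pos _ _ yl; have s'0 := pos _ _ yl'.
have /eqP := mulIf bj0 (etrans (esym ja) ka).
rewrite eqr_div ?pnatr_eq0 -?lt0n// -!natrM eqr_nat => /eqP E.
have ss' : s = s'.
  apply/eqP; rewrite eqn_dvd; apply/andP; split.
    by rewrite -(Gauss_dvdr s' (_ : coprime s r)) 1?coprime_sym// E dvdn_mull.
  by rewrite -(Gauss_dvdr s (_ : coprime s' r')) 1?coprime_sym// -E dvdn_mull.
by subst s'; move/eqP: E; rewrite eqn_pmul2r// => /eqP ->.
Qed.

Lemma cabE a b r s : (1 < b)%N -> is_reduced_form a b (r, s) ->
  cab a b = b%:Z - 1 - ((b%:Z - 1) %/ r%:Z)%Z - (((gcdn b r)%:Z - 1) %/ s%:Z)%Z.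
Proof.
move=> b1 H; rewrite /cab /reduced_form; case: xgetP => [rs|/(_ (r, s))//].
by move=> _ /(reduced_form_unique b1 H) <-.
Qed.

End LeadingDigit.

(* Main.v *)
Require Import Defs.
From mathcomp Require Import all_boot all_order all_algebra finmap.
From mathcomp Require Import boolp classical_sets functions cardinality reals.
From mathcomp Require Import zify ring lra.

(** Multiplication by a acts on positive reals modulo powers of b, that is on a
circle, and the leading digit sequence codes the orbit of 1 by the arcs cut out
by the digits 1, ..., b - 1. The word of length n read from x is constant on the
arcs between consecutive breakpoints d / a^i with d a digit and i < n. No
positive power of a is a power of b, because b is squarefree, so the orbit is dense
([orbit_dense]) and meets every such arc: the blocks of length n are exactly the
words read from breakpoints ([blocks_breakpoint]). As every arc of the digit
partition is short (b >= 4), different breakpoints give different words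
([word_breakpoint_inj]). Hence the complexity is the number of breakpoints
modulo powers of b.

The breakpoint d / a^i with i > 0 coincides with one of smaller exponent when
d = d' a b^j for a digit d', and such digits d are called inherited. For b
squarefree, a coincidence d = d' a^m b^j with m >= 1 already forces d to be
inherited ([inherited_orbit]), so each step from n to n + 1 adds exactly one
breakpoint for each digit that is not inherited, and
p(n) = (b - 1) + c (n - 1) with c the number of these digits ([complexityE]).

Writing a = (r / s) b^k in reduced form, d is inherited iff r divides d or d is a
multiple of r / gcd(b, r) smaller than r / s. These cases are exclusive, and
counting them gives c = c_{a,b} ([cab_count]). The bounds on p(n) then follow
from floor((b - 1) / 2) <= c <= b - 1, whose lower half is the elementary
inequality [inherited_bound]; for a = b + 1 no digit is inherited, while for
a = 2 the count is computed by the parity of b. *)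

Import Order.TTheory GRing.Theory Num.Theory.

Set Implicit Arguments.
Unset Strict Implicit.
Unset Printing Implicit Defensive.

(** * Inherited digits *)

Section Inherited.
Local Open Scope nat_scope.

(** The digits d of the form d' (r / s) b^j with d' a digit. As 1 < r / s < b, the
    exponent j is 0 or -1, and the two disjuncts express these two cases. *)
Definition inherited (b r s d : nat) : bool :=
  (r %| d) || ((r %/ gcdn b r %| d) && (s * d < r)).

Lemma squarefree_logn b p : squarefree b -> logn p b <= 1.
Proof.
move=> sqb; rewrite leqNgt; apply/negP => lp.
have pp : prime p by rewrite ltnNge in lp; apply: contraR lp => pp; rewrite lognE (negbTE pp).
have b0 : 0 < b by case: b lp {sqb} => //; rewrite logn0.
by have := sqb p; rewrite (pfactor_dvdn _ pp b0) lp => /(_ isT) p1; rewrite p1 in pp.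
Qed.

(** This is where squarefreeness of b enters: a prime p of r has valuation at
    most j < m in b^j, so that of d is at least m (v_p(r) - 1) + 1 >= v_p(r). *)
Lemma dvdn_root b r d m j : squarefree b -> 0 < b -> 0 < r -> 0 < d -> j < m ->
  r ^ m %| d * b ^ j -> r %| d.
Proof.
move=> sqb b0 r0 d0 jm div.
apply/dvdn_partP => // p; rewrite mem_primes r0 /= => /andP[pp pr].
have lr : 0 < logn p r by rewrite logn_gt0 mem_primes pp r0.
rewrite p_part pfactor_dvdn //.
have := dvdn_leq_log p _ div; rewrite muln_gt0 d0 expn_gt0 b0 => /(_ isT).
rewrite lognM ?expn_gt0 ?b0 // !lognX.
by have := squarefree_logn p sqb; nia.
Qed.

Lemma count_dvdn_iota q N : 0 < q -> count (dvdn q) (iota 1 N) = N %/ q.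
Proof.
move=> q0; elim: N => [|N IH]; first by rewrite div0n.
by rewrite -[N.+1]addn1 iotaD count_cat IH /= add1n addn0 addn1 divnS // addnC.
Qed.

Section Arith.
Context (b r s : nat).
Context (sqb : squarefree b) (b2 : 1 < b) (rs : coprime r s).
Context (sr : s < r) (rsb : r < s * b).

Let s0 : 0 < s. Proof. by case: s rsb. Qed.
Let r0 : 0 < r. Proof. exact: leq_ltn_trans sr. Qed.
Let b0 : 0 < b. Proof. exact: ltnW. Qed.

(** The case d = d' (r / s)^m / b^j of a coincidence. Size forces j <= m. If
    j < m then r divides d by [dvdn_root]. If j = m then, with r = g q and
    b = g c for g = gcd(b, r), the fraction q / (s c) is reduced and
    d = d' (q / (s c))^m, so q^m divides d and (s c)^m divides d'. *)
Lemma inherited_wrap d d' m j : 0 < d < b -> 0 < d' < b -> 0 < m ->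
  d * s ^ m * b ^ j = d' * r ^ m -> inherited b r s d.
Proof.
move=> /andP[d0 db] /andP[d'0 d'b] m0 E.
have jm : j <= m.
  rewrite leqNgt; apply/negP => mj.
  have rm : r ^ m < (s * b) ^ m by rewrite ltn_exp2r.
  have bj : b ^ m.+1 <= b ^ j by rewrite leq_exp2l.
  have sm : 0 < s ^ m by rewrite expn_gt0 s0.
  have bm : 0 < b ^ m by rewrite expn_gt0 b0.
  move: rm bj; rewrite expnMn expnS => rm bj.
  have h1 : d * s ^ m * (b * b ^ m) <= d' * r ^ m by rewrite -E leq_pmul2l // muln_gt0 d0.
  have h2 : d' * r ^ m < d' * (s ^ m * b ^ m) by rewrite ltn_pmul2l.
  have := leq_ltn_trans h1 h2.
  have -> : d * s ^ m * (b * b ^ m) = (d * b) * (s ^ m * b ^ m) by ring.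
  rewrite ltn_pmul2r ?muln_gt0 ?sm // ltnNge => /negP; apply.
  by apply: leq_trans (ltnW d'b) _; rewrite leq_pmull.
rewrite /inherited; move: jm; rewrite leq_eqVlt => /orP[/eqP jm|jm]; last first.
  apply/orP; left; apply: (@dvdn_root b r d m j) => //.
  rewrite -(@Gauss_dvdr _ (s ^ m)); first by rewrite mulnCA mulnA E dvdn_mull.
  by rewrite coprimeXl // coprimeXr.
apply/orP; right; subst j.
set g := gcdn b r.
have g0 : 0 < g by rewrite gcdn_gt0 b0.
set q := r %/ g; have rE : r = g * q by rewrite mulnC divnK // dvdn_gcdr.
set c := b %/ g; have bE : b = g * c by rewrite mulnC divnK // dvdn_gcdl.
have q0 : 0 < q by move: r0; rewrite rE muln_gt0 => /andP[].
have c0 : 0 < c by move: b0; rewrite bE muln_gt0 => /andP[].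
have cq : coprime c q.
  rewrite /coprime -(eqn_pmul2l g0) muln_gcdr -bE -rE muln1 //.
have E2 : d * (s * c) ^ m = d' * q ^ m.
  apply/eqP; have gm : 0 < g ^ m by rewrite expn_gt0 g0.
  rewrite -(eqn_pmul2l gm).
  have -> : g ^ m * (d' * q ^ m) = d' * r ^ m by rewrite rE expnMn; ring.
  have -> : g ^ m * (d * (s * c) ^ m) = d * s ^ m * b ^ m.
    by rewrite bE !expnMn; ring.
  by rewrite E.
have qsc : coprime q (s * c).
  rewrite coprimeMr [coprime q c]coprime_sym cq andbT.
  by apply: coprime_dvdl rs; rewrite rE dvdn_mull.
have qmd : q ^ m %| d.
  rewrite -(@Gauss_dvdl _ _ ((s * c) ^ m)) ?E2 ?dvdn_mull //.
  by rewrite coprimeXl // coprimeXr.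
have [t dE] := dvdnP qmd.
have t0 : 0 < t by move: d0; rewrite dE muln_gt0 => /andP[].
have qm0 : 0 < q ^ m by rewrite expn_gt0 q0.
have d'E : d' = t * (s * c) ^ m.
  apply/eqP; rewrite -(eqn_pmul2r qm0) -E2 dE; apply/eqP; ring.
apply/andP; split; first by apply: dvdn_trans qmd; rewrite dvdn_exp.
have qlt : q < s * c.
  by rewrite -(ltn_pmul2l g0) -rE mulnCA -bE.
case: m m0 dE d'E {E E2 qmd qm0} => // m _ dE d'E.
(* d = t q^(m+1) and d' = t (s c)^(m+1) < b = g c give t s (s c)^m < g, and
   q <= s c turns this into s d < g q = r. *)
have h : q ^ m <= (s * c) ^ m.
  by case: (posnP m) => [->//|m0]; rewrite leq_exp2r // ltnW.
move: d'b; rewrite d'E dE rE bE => hb.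
have hg : t * s * (s * c) ^ m < g.
  rewrite -(ltn_pmul2r c0); apply: leq_ltn_trans hb.
  by rewrite expnS leq_eqVlt; apply/orP; left; apply/eqP; ring.
have -> : s * (t * q ^ m.+1) = t * s * q ^ m * q by rewrite expnS; ring.
rewrite ltn_pmul2r //; apply: leq_ltn_trans hg.
by rewrite leq_pmul2l // muln_gt0 t0.
Qed.

(** The case d = d' (r / s)^m b^j of a coincidence: r^m is coprime to s^m. *)
Lemma inherited_nowrap d d' m j : 0 < d < b -> 0 < m ->
  d * s ^ m = d' * r ^ m * b ^ j -> inherited b r s d.
Proof.
move=> /andP[d0 db] m0 E; apply/orP; left.
apply: (@dvdn_trans (r ^ m)); first by rewrite dvdn_exp.
rewrite -(@Gauss_dvdl _ _ (s ^ m)); first by rewrite E mulnAC dvdn_mull.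
by rewrite coprimeXl // coprimeXr.
Qed.

Lemma inherited_witness d : 0 < d < b -> inherited b r s d ->
  exists2 d', 0 < d' < b & (d * s == d' * r) || (d * s * b == d' * r).
Proof.
move=> /andP[d0 db] /orP[/dvdnP[t dE]|/andP[]].
  exists (t * s); last by rewrite dE; apply/orP; left; apply/eqP; ring.
  have t0 : 0 < t by move: d0; rewrite dE muln_gt0 => /andP[].
  rewrite muln_gt0 t0 s0 /=; apply: leq_ltn_trans db.
  by rewrite dE leq_pmul2l // ltnW.
set g := gcdn b r.
have g0 : 0 < g by rewrite gcdn_gt0 b0.
set q := r %/ g; have rE : r = g * q by rewrite mulnC divnK // dvdn_gcdr.
set c := b %/ g; have bE : b = g * c by rewrite mulnC divnK // dvdn_gcdl.
have q0 : 0 < q by move: r0; rewrite rE muln_gt0 => /andP[].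
have c0 : 0 < c by move: b0; rewrite bE muln_gt0 => /andP[].
move=> /dvdnP[t dE] sd.
have t0 : 0 < t by move: d0; rewrite dE muln_gt0 => /andP[].
exists (t * s * c); last first.
  by apply/orP; right; apply/eqP; rewrite dE rE bE; ring.
rewrite !muln_gt0 t0 s0 c0 /= bE ltn_pmul2r //.
by move: sd; rewrite dE rE mulnCA mulnA [t * s * q]mulnC [g * q]mulnC ltn_pmul2l.
Qed.

Lemma count_inherited :
  count (inherited b r s) (iota 1 b.-1) = b.-1 %/ r + (gcdn b r).-1 %/ s.
Proof.
set g := gcdn b r.
have g0 : 0 < g by rewrite gcdn_gt0 b0.
set q := r %/ g; have rE : r = g * q by rewrite mulnC divnK // dvdn_gcdr.
have q0 : 0 < q by move: r0; rewrite rE muln_gt0 => /andP[].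
(* A common digit d would satisfy r <= d and s d < r. *)
have := count_predUI (dvdn r) (fun d => (q %| d) && (s * d < r)) (iota 1 b.-1).
rewrite [X in _ + X = _ -> _](_ : _ = 0); last first.
  rewrite (eq_in_count (a2 := pred0)) ?count_pred0 // => d; rewrite mem_iota => /andP[d0 _].
  apply/negP => /= /andP[/(dvdn_leq d0) rd /andP[_ sd]]; nia.
rewrite addn0 => ->; rewrite count_dvdn_iota //; congr (_ + _).
set M := r.-1 %/ s.
have hM : M <= b.-1.
  have : M < b by rewrite ltn_divLR // prednK ?(mulnC b) // ltnW.
  by case: b b0.
(* Only the digits d <= M = floor((r - 1) / s) satisfy s d < r, and the count over
   them is floor(M / q) = floor((g - 1) / s), because floor((r - 1) / q) = g - 1. *)
rewrite -(subnKC hM) iotaD count_cat [X in _ + X](_ : _ = 0); last first.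
  rewrite (eq_in_count (a2 := pred0)) ?count_pred0 // => d; rewrite mem_iota => /andP[d0 _] /=.
  apply/negP => /andP[_ sd]; move: d0; rewrite add1n ltnNge; apply/negP/negPn.
  by rewrite leq_divRL // mulnC -ltnS prednK.
rewrite addn0 (eq_in_count (a2 := dvdn q)); last first.
  move=> d; rewrite mem_iota add1n ltnS => /andP[_]; rewrite leq_divRL // => sd.
  by rewrite -(prednK r0) ltnS mulnC sd andbT.
rewrite count_dvdn_iota // /M -divnMA mulnC divnMA; congr (_ %/ _).
have -> : r.-1 = g.-1 * q + q.-1 by rewrite rE; nia.
by rewrite divnMDl // divn_small ?addn0 // prednK.
Qed.

(** The extreme case is g = gcd(b, r) > 1 with r < b: then g <= r is a proper
    divisor of b = g c, and (c - 1) + (g - 1) <= b / 2 as g, c >= 2. If g = 1 the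
    second term vanishes and r >= 2; if r >= b the first one vanishes and s >= 2. *)
Lemma inherited_bound : b.-1 %/ r + (gcdn b r).-1 %/ s <= uphalf b.-1.
Proof.
clear sqb rs.
set g := gcdn b r.
have g0 : 0 < g by rewrite gcdn_gt0 b0.
set q := r %/ g; have rE : r = g * q by rewrite mulnC divnK // dvdn_gcdr.
set c := b %/ g; have bE : b = g * c by rewrite mulnC divnK // dvdn_gcdl.
have gr : g <= r by rewrite dvdn_leq // dvdn_gcdr.
have r2 : 1 < r by apply: leq_ltn_trans sr.
have [g1|g2] := leqP g 1.
  have -> : g.-1 = 0 by lia.
  rewrite div0n addn0; apply: (leq_trans (leq_div2l _ (isT : 0 < 2) r2)); lia.
have [br|rb] := leqP b r.
  rewrite (divn_small (m := b.-1)) ?add0n; last lia.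
  have s2 : 1 < s by nia.
  apply: (leq_trans (leq_div2l _ (isT : 0 < 2) s2)).
  have : g <= b by rewrite dvdn_leq ?dvdn_gcdl.
  lia.
apply: (@leq_trans (b.-1 %/ g + g.-1)).
  by apply: leq_add; [exact: leq_div2l | exact: leq_div].
have -> : b.-1 %/ g = c.-1.
  have c0 : 0 < c by move: b0; rewrite bE muln_gt0 => /andP[].
  have -> : b.-1 = c.-1 * g + g.-1 by rewrite bE; nia.
  by rewrite divnMDl // divn_small ?addn0 // prednK.
have c2 : 1 < c by nia.
have : g.-1 + c.-1 <= b./2 by nia.
lia.
Qed.

Lemma count_not_inherited_bounds :
  (b - 1)./2 <= count (predC (inherited b r s)) (iota 1 b.-1) <= b - 1.
Proof.
have := count_predC (inherited b r s) (iota 1 b.-1).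
rewrite count_inherited // size_iota.
have := inherited_bound.
set N := (_ %/ r + _); set c := count (predC _) _; lia.
Qed.
End Arith.

End Inherited.

Local Open Scope ring_scope.

(** * Words read along an orbit *)

Section Words.
Context {R : realType}.
Context (b : nat) (b1 : (1 < b)%N).
Implicit Types (a x y q : R).

Let b0 : 0 < b%:R :> R. Proof. by rewrite ltr0n ltnW. Qed.
Let bn0 : b%:R != 0 :> R. Proof. by rewrite gt_eqF. Qed.
Let bz0 j : 0 < b%:R ^ j :> R. Proof. by rewrite exprz_gt0. Qed.

Definition word a n x : seq nat := [seq lead_digit b (a ^+ i * x) | i <- iota 0 n].

Definition scale_eq x y := exists j : int, x = y * b%:R ^ j.

(** A point at which the word of length n may change. *)
Definition breakpoint a n q := exists i d (j : int),
  [/\ (i < n)%N, (0 < d < b)%N & q = d%:R * b%:R ^ j / a ^+ i].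

Lemma block_word a n m : block a b n m = word a n (a ^+ m).
Proof.
rewrite /block /word -[m in LHS]addn0 iotaDl -map_comp.
by apply: eq_map => i /=; rewrite -exprD addnC.
Qed.

Lemma lead_digit_spec x : 0 < x -> is_lead_digit b x (lead_digit b x).
Proof. by move=> x0; apply/lead_digitP. Qed.

Lemma lead_digit_scale x j : 0 < x -> lead_digit b (x * b%:R ^ j) = lead_digit b x.
Proof.
move=> x0; apply/lead_digitP => //; first by rewrite mulr_gt0.
have [db [k /andP[h1 h2]]] := lead_digit_spec x0.
split=> //; exists (k + j); rewrite expfzDr // !mulrA.
by rewrite ler_pM2r // ltr_pM2r // h1.
Qed.

Lemma word_scale a n x j : 0 < a -> 0 < x -> word a n (x * b%:R ^ j) = word a n x.
Proof.
move=> a0 x0; apply: eq_map => i.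
by rewrite mulrA lead_digit_scale // mulr_gt0 // exprn_gt0.
Qed.

Lemma nth_word a n x i : (i < n)%N -> nth 0%N (word a n x) i = lead_digit b (a ^+ i * x).
Proof. by move=> lt_in; rewrite (nth_map 0%N) ?size_iota // nth_iota. Qed.

Lemma wordS a n x : word a n.+1 x = rcons (word a n x) (lead_digit b (a ^+ n * x)).
Proof. by rewrite /word -addn1 iotaD map_cat /= add0n cats1. Qed.

(** The digit of a^i x is constant on an interval starting at a breakpoint; the
    intersection of these intervals over i starts at the largest of these
    breakpoints. *)
Lemma word_cylinder a n x : 0 < a -> 0 < x -> exists lo hi,
  [/\ lo <= x < hi, breakpoint a n.+1 lo
    & forall z, lo <= z < hi -> word a n.+1 z = word a n.+1 x].
Proof.
move=> a0 x0.
have digit i : exists lo hi, [/\ lo <= x < hi, breakpoint a i.+1 lo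
    & forall z, lo <= z < hi -> lead_digit b (a ^+ i * z) = lead_digit b (a ^+ i * x)].
  have ai0 : 0 < a ^+ i by rewrite exprn_gt0.
  have aix0 : 0 < a ^+ i * x by rewrite mulr_gt0.
  have [db [j /andP[h1 h2]]] := lead_digit_spec aix0.
  set d := lead_digit b _ in db h1 h2 *.
  have d0 : 0 < d%:R :> R by rewrite ltr0n; case/andP: db.
  exists (d%:R * b%:R ^ j / a ^+ i), (d.+1%:R * b%:R ^ j / a ^+ i).
  have eq_itv z : (d%:R * b%:R ^ j / a ^+ i <= z < d.+1%:R * b%:R ^ j / a ^+ i) =
      (d%:R * b%:R ^ j <= a ^+ i * z < d.+1%:R * b%:R ^ j).
    by rewrite ler_pdivrMr // ltr_pdivlMr // [z * _]mulrC.
  split; first by rewrite eq_itv h1.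
    by exists i, d, j.
  move=> z; rewrite eq_itv => /andP[z1 z2]; apply/lead_digitP => //.
    by apply: lt_le_trans z1; rewrite mulr_gt0.
  by split=> //; exists j; rewrite z1.
elim: n => [|n [lo [hi [/andP[lox xhi] blo eqw]]]].
  have [lo [hi [xin blo eqd]]] := digit 0%N.
  by exists lo, hi; split=> // z zin; rewrite /word /= eqd.
have [lo' [hi' [/andP[lox' xhi'] blo' eqd]]] := digit n.+1.
exists (Num.max lo lo'), (Num.min hi hi'); split.
- by rewrite ge_max lt_min lox lox' xhi.
- case: (leP lo lo') => // _; case: blo => i [d [j [iltn db ->]]].
  by exists i, d, j; split=> //; apply: ltnW.
- move=> z; rewrite ge_max lt_min => /andP[/andP[z1 z2] /andP[z3 z4]].
  by rewrite wordS [RHS]wordS eqw ?z1 // eqd // z2.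
Qed.

(** Write q = d b^k / a^i. Just below q the i-th digit is not d, and it becomes d
    again only below q by a factor exceeding d b / (d + 1) >= b / 2 >= 2. *)
Lemma breakpoint_separates a n q x : (4 <= b)%N -> 0 < a -> 0 < x ->
  breakpoint a n q -> x < q < 2 * x -> word a n x <> word a n q.
Proof.
move=> b4 a0 x0 [i [d [k [iltn db qE]]]] /andP[xq qx] E.
have ai0 : 0 < a ^+ i by rewrite exprn_gt0.
have aqE : a ^+ i * q = d%:R * b%:R ^ k by rewrite qE mulrC divfK ?gt_eqF.
have d1 : 1 <= d%:R :> R by rewrite ler1n; case/andP: db.
have dq : lead_digit b (a ^+ i * q) = d.
  apply/lead_digitP => //; first by rewrite mulr_gt0 // (lt_trans x0).
  by split=> //; exists k; rewrite aqE lexx ltr_pM2r // ltr_nat /=.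
have := congr1 (nth 0%N ^~ i) E; rewrite !nth_word // dq.
move=> /(lead_digitP _ b1) []; first by rewrite mulr_gt0.
move=> _ [l /andP[h1 h2]].
have aix : a ^+ i * x < d%:R * b%:R ^ k by rewrite -aqE ltr_pM2l.
have lk : l + 1 <= k.
  have := le_lt_trans h1 aix; rewrite ltr_pM2l ?(lt_le_trans ltr01) //.
  by rewrite ltr_eXz2l ?ltr1n // lezD1.
have : d%:R * b%:R ^ (l + 1) <= d%:R * b%:R ^ k :> R.
  by rewrite ler_pM2l ?(lt_le_trans ltr01) // ler_eXz2l // ltr1n.
rewrite expfzDr // expr1z -aqE => h3.
have h4 : a ^+ i * q < a ^+ i * (2 * x) by rewrite ltr_pM2l.
have b4R : 4 <= b%:R :> R by rewrite ler_nat.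
have : d%:R * b%:R ^ l * 4 <= d%:R * b%:R ^ l * b%:R :> R.
  by rewrite ler_pM2l // mulr_gt0 // (lt_le_trans ltr01).
have : b%:R ^ l <= d%:R * b%:R ^ l :> R by rewrite ler_peMl // ltW.
move: h2 h3 h4; rewrite -[d.+1%:R]natr1 mulrDl mul1r [_ * (2 * x)]mulrCA [d%:R * (_ * _)]mulrA.
set B := b%:R ^ l; set D := d%:R * B; set X := a ^+ i * x.
lra.
Qed.

Lemma word_breakpoint_inj a n q q' : (4 <= b)%N -> 0 < a ->
  breakpoint a n.+1 q -> breakpoint a n.+1 q' ->
  word a n.+1 q = word a n.+1 q' -> scale_eq q q'.
Proof.
move=> b4 a0 bq bq' E.
have pos p : breakpoint a n.+1 p -> 0 < p.
  move=> [i [d [k [_ /andP[d0 _] ->]]]].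
  by rewrite divr_gt0 ?exprn_gt0 // mulr_gt0 // ltr0n.
have q0 := pos _ bq; have q'0 := pos _ bq'.
have [d [[db [j /andP[h1 h2]]] [_ [k /andP[h3 h4]]]]] :
    exists d, is_lead_digit b q d /\ is_lead_digit b q' d.
  exists (lead_digit b q); split; first exact: lead_digit_spec.
  have := congr1 (nth 0%N ^~ 0%N) E; rewrite !nth_word // !expr0 !mul1r => ->.
  exact: lead_digit_spec.
(* Equal first digits let q' be rescaled into the arc of q, whose endpoints have
   ratio (d + 1) / d <= 2. *)
pose p := q' * b%:R ^ (j - k).
have bp : breakpoint a n.+1 p.
  case: bq' => i [e [l [iltn eb q'E]]]; exists i, e, (l + (j - k)); split=> //.
  by rewrite /p q'E [X in _ = _ * X / _]expfzDr // mulrA mulrAC.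
have Ep : word a n.+1 q = word a n.+1 p by rewrite word_scale.
have bjk : b%:R ^ k * b%:R ^ (j - k) = b%:R ^ j :> R by rewrite -expfzDr // addrC subrK.
have p1 : d%:R * b%:R ^ j <= p by rewrite -bjk mulrA ler_pM2r.
have p2 : p < d.+1%:R * b%:R ^ j by rewrite -bjk mulrA ltr_pM2r.
have d2 : d.+1%:R * b%:R ^ j <= 2 * (d%:R * b%:R ^ j) :> R.
  rewrite mulrA ler_pM2r // -natrM ler_nat; case/andP: db; lia.
case: (ltgtP q p) => [qp|pq|->]; last by exists (j - k).
- exfalso; apply: (breakpoint_separates b4 a0 q0 bp) Ep.
  by rewrite qp; lra.
- exfalso; apply: (breakpoint_separates b4 a0 (pos _ bp) bq) (esym Ep).
  by rewrite pq; lra.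
Qed.
End Words.

(** * Density of the orbit *)

Section Density.
Context {R : realType}.
Implicit Types (a x y u : R).

Lemma bernoulli_ineq u t : -1 <= u -> 1 + t%:R * u <= (1 + u) ^+ t.
Proof.
move=> u1; elim: t => [|t IH]; first by rewrite mul0r addr0 expr0.
rewrite exprSr -natr1; have t0 : 0 <= t%:R :> R by [].
have u2 : 0 <= 1 + u by lra.
have := ler_wpM2r u2 IH; have : 0 <= t%:R * (u * u) by rewrite mulr_ge0 // -expr2 sqr_ge0.
set T := t%:R; set P := _ ^+ t; nra.
Qed.

Lemma expr_unbounded u x : 1 < u -> exists t, x < u ^+ t.
Proof.
move=> u1; have h0 : 0 < u - 1 by rewrite subr_gt0.
have [x0|x0] := leP x 0; first by exists 0%N; rewrite expr0; lra.
have /archi_boundP : 0 <= x / (u - 1) by rewrite divr_ge0 ?ltW.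
set t := Num.bound _; rewrite ltr_pdivrMr // => xt; exists t.
have := @bernoulli_ineq (u - 1) t; rewrite [1 + (u - 1)]addrC subrK => h.
by apply: lt_le_trans xt _; apply: le_trans (h _); lra.
Qed.

Context (b : nat) (b1 : (1 < b)%N).
Let b0 : 0 < b%:R :> R. Proof. by rewrite ltr0n ltnW. Qed.
Let bn0 : b%:R != 0 :> R. Proof. by rewrite gt_eqF. Qed.
Let bz0 j : 0 < b%:R ^ j :> R. Proof. by rewrite exprz_gt0. Qed.

Context (a : R) (a0 : 0 < a).
Context (indep : forall m (j : int), (0 < m)%N -> a ^+ m <> b%:R ^ j).

(** Pigeonhole: two among N + 1 powers of a, rescaled to [1, b[, lie in the same
    cell of length e, and their quotient is within e of 1. *)
Lemma orbit_near_one e : 0 < e -> exists m (j : int),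
  [/\ (0 < m)%N, a ^+ m * b%:R ^ j != 1 & `|a ^+ m * b%:R ^ j - 1| < e].
Proof.
move=> e0.
have /boolp.choice[z zP] : forall m : nat, exists y, 1 <= y < b%:R /\
    exists j : int, y = a ^+ m * b%:R ^ j.
  move=> m; have [j /andP[h1 h2]] := @exprz_bracket R b (a ^+ m) b1 (exprn_gt0 m a0).
  exists (a ^+ m * b%:R ^ (- j)); split; last by exists (- j).
  rewrite -invr_expz ler_pdivlMr // ltr_pdivrMr // mul1r h1 /=.
  by rewrite mulrC -[X in _ * X]expr1z -expfzDr.
have [N beN] : exists N : nat, b%:R / e < N%:R.
  by exists (Num.bound (b%:R / e)); apply: archi_boundP; rewrite divr_ge0 ?ltW.
have z1 m : 1 <= z m by case: (zP m) => /andP[].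
have z0 m : 0 < z m by apply: lt_le_trans (z1 m).
have ze0 m : 0 <= z m / e by rewrite divr_ge0 ?ltW.
have cellP m : (Num.truncn (z m / e) < N)%N.
  rewrite truncn_lt_nat //; apply: lt_trans beN.
  by rewrite ltr_pM2r ?invr_gt0 //; case: (zP m) => /andP[].
pose cell (m : 'I_N.+1) := Ordinal (cellP m).
have : ~~ injectiveb cell.
  by apply/negP => /injectiveP /leq_card; rewrite !card_ord ltnn.
case/injectivePn => i [j ij cij].
wlog {ij} ij : i j cij / (i < j)%N.
  move=> W; case: (ltngtP i j) => [| |/val_inj/eqP]; last by rewrite (negbTE ij).
    exact: W.
  by apply: W.
have [_ [k zi]] := zP i; have [_ [l zj]] := zP j.
have uz : a ^+ (j - i) * b%:R ^ (l - k) * z i = z j.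
  rewrite zi zj mulrACA -exprD -expfzDr //.
  by rewrite subrK subnK // ltnW.
exists (j - i)%N, (l - k); rewrite subn_gt0.
set u := a ^+ (j - i) * _ in uz *.
have zij : `|z j - z i| < e.
  have /andP[c1 c2] := truncn_itv (ze0 i).
  have /andP[c3 c4] := truncn_itv (ze0 j).
  move/(congr1 val): cij => /= cij; rewrite -cij in c3 c4.
  rewrite -(ltr_pM2r (_ : 0 < e^-1)) ?invr_gt0 // mulfV ?gt_eqF //.
  rewrite -[e^-1 in X in X < _]gtr0_norm ?invr_gt0 // -normrM mulrBl ltr_norml.
  move: c1 c2 c3 c4; rewrite -natr1; set A := z i / e; set B := z j / e.
  by move=> *; apply/andP; split; lra.
split=> //.
  apply/eqP => u1; apply: (indep (m := j - i) (j := k - l)); first by rewrite subn_gt0.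
  apply: (mulIf (_ : b%:R ^ (l - k) != 0)); first by rewrite gt_eqF.
  by rewrite -/u u1 -expfzDr // addrA subrK subrr.
apply: le_lt_trans zij.
have -> : z j - z i = (u - 1) * z i by rewrite -uz mulrBl mul1r.
by rewrite normrM (gtr0_norm (z0 i)) ler_peMr // z1.
Qed.

(** The powers of an element u of the orbit close enough to 1 move by steps that
    cannot jump over the interval; the walk starts at a power of b on the side
    of the interval that u moves away from. *)
Lemma orbit_dense x y : 0 < x -> x < y -> exists m (j : int),
  (0 < m)%N /\ x <= a ^+ m * b%:R ^ j < y.
Proof.
move=> x0 xy; have y0 : 0 < y by apply: lt_trans xy.
have e0 : 0 < (y - x) / y by rewrite divr_gt0 // subr_gt0.
have [m [j [m0 u1 ue]]] := orbit_near_one e0.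
set u := a ^+ m * b%:R ^ j in u1 ue.
have u0 : 0 < u by rewrite mulr_gt0 // exprn_gt0.
have uE t k : u ^+ t * b%:R ^ k = a ^+ (m * t) * b%:R ^ (j * t%:Z + k).
  by rewrite exprMn -exprM expfzDr // mulrA -exprz_exp.
suff [t [k [t0 htk]]] : exists t (k : int), (0 < t)%N /\ x <= u ^+ t * b%:R ^ k < y.
  by exists (m * t)%N, (j * t%:Z + k); rewrite muln_gt0 m0 t0 -uE.
(* The choice e = (y - x) / y bounds a step on both sides of 1, as x < y. *)
have [ule uge] : y * u < y + (y - x) /\ x < y * u.
  move: ue; rewrite ltr_pdivlMr // -{1}(gtr0_norm y0) -normrM ltr_norml => /andP[].
  by move=> *; split; lra.
case/orP: (lt_total u1) => u_1.
- have [i /andP[_]] := exprz_bracket b1 y0; set k := i + 1 => yk.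
  have v1 : 1 < u^-1 by rewrite invf_gt1.
  have ex : exists t : nat, u ^+ t * b%:R ^ k < y.
    have [t ht] := expr_unbounded (b%:R ^ k / y) v1; exists t.
    by move: ht; rewrite ltr_pdivrMr // exprVn mulrC ltr_pdivlMr ?exprn_gt0 // mulrC.
  case: (ex_minnP ex) => -[|t] ht mint.
    by move: ht; rewrite expr0 mul1r ltNge ltW.
  exists t.+1, k; split=> //; rewrite ht andbT.
  have : y <= u ^+ t * b%:R ^ k by rewrite leNgt; apply/negP => /mint; rewrite ltnn.
  move=> /(ler_wpM2r (ltW u0)) h; apply: le_trans (ltW uge) (le_trans h _).
  by rewrite exprSr mulrAC.
- have [k /andP[kx _]] := exprz_bracket b1 x0.
  have ex : exists t : nat, x < u ^+ t * b%:R ^ k.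
    have [t ht] := expr_unbounded (x / b%:R ^ k) u_1; exists t.
    by move: ht; rewrite ltr_pdivrMr.
  case: (ex_minnP ex) => -[|t] ht mint.
    by move: ht; rewrite expr0 mul1r ltNge kx.
  exists t.+1, k; split=> //; rewrite (ltW ht) /=.
  have : u ^+ t * b%:R ^ k <= x by rewrite leNgt; apply/negP => /mint; rewrite ltnn.
  move=> /(ler_wpM2r (ltW u0)) h; rewrite exprSr mulrAC; apply: le_lt_trans h _.
  have : (u - 1) * x < (u - 1) * y by rewrite ltr_pM2l // subr_gt0.
  move: ule; rewrite !mulrBl !mul1r.
  rewrite [u * x]mulrC [u * y]mulrC; lra.
Qed.
End Density.

(** * Complexity as a number of breakpoints *)

Section Counting.
Context {R : realType} (b : nat) (b4 : (4 <= b)%N) (a : R) (a0 : 0 < a).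
Context (indep : forall m (j : int), (0 < m)%N -> a ^+ m <> b%:R ^ j).
Context (inh : pred nat).
Context (inhI : forall d d' m (j : int), (0 < d < b)%N -> (0 < d' < b)%N -> (0 < m)%N ->
  d%:R = d'%:R * a ^+ m * b%:R ^ j :> R -> inh d).
Context (inhE : forall d, (0 < d < b)%N -> inh d ->
  exists d' (j : int), (0 < d' < b)%N /\ d%:R = d'%:R * a * b%:R ^ j :> R).

Let b1 : (1 < b)%N. Proof. exact: leq_trans b4. Qed.
Let b0 : 0 < b%:R :> R. Proof. by rewrite ltr0n ltnW. Qed.
Let bn0 : b%:R != 0 :> R. Proof. by rewrite gt_eqF. Qed.
Let bz0 j : 0 < b%:R ^ j :> R. Proof. by rewrite exprz_gt0. Qed.
Let an0 i : a ^+ i != 0. Proof. by rewrite gt_eqF // exprn_gt0. Qed.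

Lemma breakpoint_gt0 n q : breakpoint b a n q -> 0 < q.
Proof.
move=> [i [d [k [_ /andP[d0 _] ->]]]].
by rewrite divr_gt0 ?exprn_gt0 // mulr_gt0 // ltr0n.
Qed.

(** Every word is the word of the breakpoint on the left of its arc; conversely
    the orbit enters the arc to the right of any breakpoint. *)
Lemma blocks_breakpoint n w :
  blocks a b n.+1 w <-> exists2 q, breakpoint b a n.+1 q & w = word b a n.+1 q.
Proof.
split=> [[m _ <-]|[q bq ->]].
  have am0 : 0 < a ^+ m by rewrite exprn_gt0.
  have [lo [hi [/andP[lox xhi] blo eqw]]] := word_cylinder b1 n a0 am0.
  by exists lo => //; rewrite block_word eqw // lexx (le_lt_trans lox).
have q0 := breakpoint_gt0 bq.
have [lo [hi [/andP[loq qhi] _ eqw]]] := word_cylinder b1 n a0 q0.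
have [m [j [m0 /andP[h1 h2]]]] := orbit_dense b1 a0 indep q0 qhi.
exists m => //; rewrite block_word -(word_scale b1 _ j) ?exprn_gt0 //.
by rewrite eqw // h2 (le_trans loq).
Qed.

(** One representative (d, i) of each breakpoint d / a^i modulo powers of b: for
    i > 0 an inherited digit d gives a breakpoint that also has a smaller exponent. *)
Definition fresh n : seq (nat * nat) :=
  [seq (d, 0%N) | d <- iota 1 b.-1] ++
  [seq (d, i) | d <- filter (predC inh) (iota 1 b.-1), i <- iota 1 n].

Definition point (p : nat * nat) : R := p.1%:R / a ^+ p.2.

Lemma mem_fresh n d i : ((d, i) \in fresh n) =
  [&& (0 < d < b)%N, (i <= n)%N & (i == 0%N) || ~~ inh d].
Proof.
have mem_digit e : (e \in iota 1 b.-1) = (0 < e < b)%N.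
  by rewrite mem_iota add1n prednK // ltnW.
rewrite mem_cat; apply/orP/idP.
- case=> [/mapP[e]|/allpairsP[[e k] /=]].
    by rewrite mem_digit => eb [-> ->]; rewrite eb.
  rewrite mem_filter mem_digit mem_iota add1n ltnS.
  by case=> /andP[/= ei eb] /andP[k0 kn] [-> ->]; rewrite eb kn ei orbT.
- case/and3P=> db iin; case: i iin => [_ _|i iin /= nd].
    by left; apply/mapP; exists d; rewrite ?mem_digit.
  right; apply/allpairsP; exists (d, i.+1); split=> //=.
    by rewrite mem_filter mem_digit db /= nd.
  by rewrite mem_iota add1n.
Qed.

Lemma size_fresh n : size (fresh n) = (b.-1 + count (predC inh) (iota 1 b.-1) * n)%N.
Proof. by rewrite size_cat size_map size_allpairs !size_iota size_filter. Qed.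

Lemma fresh_uniq n : uniq (fresh n).
Proof.
rewrite cat_uniq map_inj_uniq ?iota_uniq; last by move=> d e [].
rewrite allpairs_uniq ?filter_uniq ?iota_uniq //; last by move=> [d i] [e l] _ _ [-> ->].
rewrite /= andbT.
apply/hasPn => -[d i] /allpairsP[[e k] /= [_ kn [_ ->]]].
by apply/mapP => -[f _ [_ k0]]; move: kn; rewrite k0 mem_iota.
Qed.

(** If d = d' a b^k is inherited then d / a^(i+1) is d' / a^i up to a power of b. *)
Lemma breakpoint_fresh n q : breakpoint b a n.+1 q ->
  exists2 p, p \in fresh n & scale_eq b q (point p).
Proof.
case=> i [d [j [iltn db ->]]]; elim: i d j iltn db => [|i IH] d j iltn db.
  exists (d, 0%N); first by rewrite mem_fresh db.
  by exists j; rewrite /point /= expr0 !divr1.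
case: (boolP (inh d)) => [id|nd]; last first.
  exists (d, i.+1); first by rewrite mem_fresh db nd orbT andbT.
  by exists j; rewrite /point /= mulrAC.
have [d' [k [d'b dE]]] := inhE db id.
have [p pf [l E]] := IH d' (k + j) (ltnW iltn) d'b.
exists p => //; exists l; rewrite -E dE expfzDr //.
rewrite exprS invfM.
have a1 : a != 0 by rewrite gt_eqF.
by rewrite -!mulrA; congr (_ * _); field; rewrite an0 a1.
Qed.

Lemma fresh_breakpoint n p : p \in fresh n -> breakpoint b a n.+1 (point p).
Proof.
case: p => d i; rewrite mem_fresh => /and3P[db iin _].
by exists i, d, 0; split=> //; rewrite expr0z mulr1.
Qed.

(** Equality of two breakpoints with exponents i' < i says d = d' a^(i - i') b^j,
    so that d would be inherited. *)
Lemma fresh_inj n p p' : p \in fresh n -> p' \in fresh n ->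
  scale_eq b (point p) (point p') -> p = p'.
Proof.
case: p p' => [d i] [d' i'].
wlog le_i : d i d' i' / (i' <= i)%N.
  move=> W pf pf' [j E]; case: (leqP i' i) => [h|/ltnW h]; first by apply: W => //; exists j.
  symmetry; apply: W => //; exists (- j).
  by rewrite E -mulrA -expfzDr // subrr mulr1.
rewrite !mem_fresh => /and3P[db _ nd] /and3P[d'b _ _] [j].
rewrite /point /= => E.
have dE : d%:R = d'%:R * a ^+ (i - i') * b%:R ^ j :> R.
  rewrite expfB_cond; last by rewrite (negbTE (_ : a != 0)) ?gt_eqF //.
  rewrite -[LHS](divfK (an0 i)) E; ring.
case: (ltngtP i' i) => [lt_i|lt_i|eq_i].
- move: nd; rewrite (inhI db d'b _ dE) ?subn_gt0 // orbF => /eqP i0.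
  by rewrite i0 in lt_i.
- by move: le_i; rewrite leqNgt lt_i.
rewrite eq_i subnn expr0 mulr1 in dE *; congr (_, _).
have digit_is e : (0 < e < b)%N -> is_lead_digit b (e%:R : R) e.
  by move=> eb; split=> //; exists 0; rewrite expr0z !mulr1 lexx ltr_nat /=.
have dpos e : (0 < e < b)%N -> 0 < e%:R :> R by rewrite ltr0n => /andP[].
have /(lead_digitP _ b1 (dpos _ db)) <- := digit_is _ db.
have /(lead_digitP _ b1 (dpos _ d'b)) <- := digit_is _ d'b.
by rewrite dE lead_digit_scale // dpos.
Qed.

(** Only two properties of the inherited digits matter: a coincidence of
    breakpoints at any distance m >= 1 makes a digit inherited, and conversely an
    inherited digit has a coincidence at distance 1. The increments of the
    complexity are constant because the first property does not depend on m. *)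
Lemma complexityE n :
  complexity a b n.+1 = (b.-1 + count (predC inh) (iota 1 b.-1) * n)%N.
Proof.
pose ws := [seq word b a n.+1 (point p) | p <- fresh n].
have uws : uniq ws.
  rewrite map_inj_in_uniq ?fresh_uniq // => p p' pf pf' E.
  apply: (fresh_inj pf pf').
  exact: word_breakpoint_inj (fresh_breakpoint pf) (fresh_breakpoint pf') E.
rewrite -size_fresh -(size_map (fun p => word b a n.+1 (point p))) -/ws.
rewrite -(undup_id uws) -card_fseq /complexity; congr (#|` _|).
apply/fsetP => w; rewrite in_fset_set; last exact: finite_blocks.
rewrite in_fset /=; apply/idP/idP.
- rewrite inE => /blocks_breakpoint[q bq ->].
  have [p pf [j qE]] := breakpoint_fresh bq.
  have p0 := breakpoint_gt0 (fresh_breakpoint pf).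
  by rewrite qE word_scale //; apply/mapP; exists p.
- case/mapP => p pf ->; rewrite inE; apply/blocks_breakpoint.
  by exists (point p) => //; apply: fresh_breakpoint.
Qed.
End Counting.

(** * Reduced forms and the final count *)

Section Main.
Context {R : realType}.

Lemma admissible_reduced (a : R) b : admissible a b -> exists r s (k : int),
  [/\ coprime r s, (s < r)%N, (r < s * b)%N & a = r%:R / s%:R * b%:R ^ k] /\
  is_reduced_form a b (r, s).
Proof.
move=> H; have [[r s] rf] := reduced_form_exists H.
have [/= rs h1 h2 [k aE]] := rf; exists r, s, k; split=> //.
have s0 : (0 < s)%N by case: s h1 {rs h2 aE rf} => //; rewrite invr0 mulr0 ltr10.
have s0R : 0 < s%:R :> R by rewrite ltr0n.
move: h1 h2; rewrite ltr_pdivlMr // ltr_pdivrMr // mul1r -natrM !ltr_nat.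
by rewrite mulnC.
Qed.

Section Pair.
Context (a : R) (b r s : nat) (k : int).
Context (sqb : squarefree b) (b5 : (5 <= b)%N) (rs : coprime r s).
Context (sr : (s < r)%N) (rsb : (r < s * b)%N).
Context (aE : a = r%:R / s%:R * b%:R ^ k).

Let b1 : (1 < b)%N. Proof. exact: leq_trans b5. Qed.
Let b0 : 0 < b%:R :> R. Proof. by rewrite ltr0n ltnW. Qed.
Let bn0 : b%:R != 0 :> R. Proof. by rewrite gt_eqF. Qed.
Let s0 : 0 < s%:R :> R. Proof. by rewrite ltr0n; case: s rsb. Qed.
Let sn0 : s%:R != 0 :> R. Proof. by rewrite gt_eqF. Qed.

Lemma reduced_gt0 : 0 < a.
Proof.
by rewrite aE mulr_gt0 ?exprz_gt0 // divr_gt0 // ltr0n (leq_ltn_trans _ sr).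
Qed.

Lemma inherited_orbit d d' m (j : int) : (0 < d < b)%N -> (0 < d' < b)%N -> (0 < m)%N ->
  d%:R = d'%:R * a ^+ m * b%:R ^ j :> R -> inherited b r s d.
Proof.
move=> db d'b m0 E.
have {E} [l E] : exists l : int, (d * s ^ m)%N%:R = (d' * r ^ m)%N%:R * b%:R ^ l :> R.
  exists (k * m%:Z + j); rewrite !natrM !natrX E aE expfzDr // -exprz_exp -exprnP.
  rewrite exprMn expr_div_n; field; exact: expf_neq0.
case: l E => l.
  rewrite -exprnP -natrX -natrM => /eqP; rewrite eqr_nat => /eqP.
  exact: inherited_nowrap.
rewrite NegzE -exprnN => E.
have : (d * s ^ m)%N%:R * b%:R ^+ l.+1 = (d' * r ^ m)%N%:R :> R.
  by rewrite E divfK // expf_neq0.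
rewrite -natrX -natrM => /eqP; rewrite eqr_nat => /eqP.
exact: inherited_wrap.
Qed.

Lemma orbit_inherited d : (0 < d < b)%N -> inherited b r s d ->
  exists d' (j : int), (0 < d' < b)%N /\ d%:R = d'%:R * a * b%:R ^ j :> R.
Proof.
move=> db /(inherited_witness b1 sr rsb db)[d' d'b /orP[]] /eqP /(congr1 (GRing.natmul (1 : R)));
  rewrite !natrM => E.
- exists d', (- k); split=> //.
  have -> : d'%:R * a * b%:R ^ (- k) = d'%:R * r%:R / s%:R * (b%:R ^ k * b%:R ^ (- k)) :> R.
    by rewrite aE; ring.
  by rewrite -expfzDr // subrr mulr1 -E mulfK.
- exists d', (- k - 1); split=> //.
  have -> : d'%:R * a * b%:R ^ (- k - 1) = d'%:R * r%:R / s%:R * (b%:R ^ k * b%:R ^ (- k - 1)) :> R.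
    by rewrite aE; ring.
  rewrite -expfzDr // addrA subrr add0r -E exprN1; field; by rewrite sn0 bn0.
Qed.

(** A relation (r / s)^m = b^l has 0 <= l < m by size, and then r^m divides b^l,
    which is impossible by [dvdn_root]. *)
Lemma reduced_indep m (j : int) : (0 < m)%N -> a ^+ m <> b%:R ^ j.
Proof.
move=> m0 E.
have {E} [l E] : exists l : int, (r ^ m)%N%:R = (s ^ m)%N%:R * b%:R ^ l :> R.
  exists (j - k * m%:Z); rewrite expfzDr // -E -invr_expz -exprz_exp -exprnP.
  rewrite aE exprMn expr_div_n !natrX; field.
  by rewrite !expf_neq0 // gt_eqF // exprz_gt0.
have r1 : (1 < r)%N by apply: leq_ltn_trans sr; case: s rsb.
case: l E => l; last first.
  rewrite NegzE -exprnN => E.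
  have : (r ^ m)%N%:R * b%:R ^+ l.+1 = (s ^ m)%N%:R :> R.
    by rewrite E divfK // expf_neq0.
  rewrite -natrX -natrM => /eqP; rewrite eqr_nat => /eqP Esr.
  have : (s ^ m < r ^ m)%N by rewrite ltn_exp2r.
  by rewrite -Esr ltnNge leq_pmulr // expn_gt0 ltnW.
rewrite -exprnP -natrX -natrM => /eqP; rewrite eqr_nat => /eqP Ers.
have lm : (l < m)%N.
  rewrite ltnNge; apply/negP => ml.
  have : (r ^ m < (s * b) ^ m)%N by rewrite ltn_exp2r.
  by rewrite Ers expnMn ltnNge leq_mul // leq_exp2l.
have : (r %| 1)%N.
  apply: (dvdn_root sqb (ltnW b1) (ltnW r1) _ lm) => //.
  rewrite mul1n -(@Gauss_dvdr _ (s ^ m)) -?Ers //.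
  by rewrite coprimeXl // coprimeXr.
by rewrite dvdn1 => /eqP r1'; rewrite r1' in r1.
Qed.

Lemma complexity_reduced n :
  complexity a b n.+1 = (b.-1 + count (predC (inherited b r s)) (iota 1 b.-1) * n)%N.
Proof.
apply: complexityE; [exact: ltnW | exact: reduced_gt0 | exact: reduced_indep | |].
  exact: inherited_orbit.
exact: orbit_inherited.
Qed.

Lemma cab_count : is_reduced_form a b (r, s) ->
  cab a b = (count (predC (inherited b r s)) (iota 1 b.-1))%:Z.
Proof.
move=> rf; rewrite (cabE b1 rf).
have := count_predC (inherited b r s) (iota 1 b.-1).
rewrite count_inherited // size_iota => E.
have g0 : (0 < gcdn b r)%N by rewrite gcdn_gt0 (ltnW b1).
have pE (x : nat) : (0 < x)%N -> x%:Z - 1 = x.-1%:Z by lia.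
rewrite !pE ?(ltnW b1) // !divz_nat; move: E.
set u := (_ %/ r)%N; set v := (_ %/ s)%N; set c := count (predC _) _.
lia.
Qed.

End Pair.

End Main.

Theorem theorem4p1 (R : realType) :
  (forall (a : R) (b : nat), admissible a b ->
     ((b - 1)./2%:Z <= cab a b <= (b - 1)%N%:Z) /\
     (forall n : nat, (1 <= n)%N ->
        ((b - 1)./2 * n + uphalf (b - 1) <= complexity a b n <= (b - 1) * n)%N)) /\
  (forall b : nat, squarefree b -> (5 <= b)%N ->
     [/\ admissible (b%:R + 1 : R) b,
         cab (b%:R + 1 : R) b = (b - 1)%N%:Z
       & forall n : nat, (1 <= n)%N ->
           complexity (b%:R + 1 : R) b n = ((b - 1) * n)%N] /\
     [/\ admissible (2 : R) b,
         cab (2 : R) b = (b - 1)./2%:Z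
       & forall n : nat, (1 <= n)%N ->
           complexity (2 : R) b n = ((b - 1)./2 * n + uphalf (b - 1))%N]).
Proof.
split=> [a b adm|b sqb b5].
  have [sqb b5 _ _ _] := adm.
  have [r [s [k [[rs sr rsb aE] rf]]]] := admissible_reduced adm.
  have /andP[c1 c2] := count_not_inherited_bounds (ltn_trans (isT : 1 < 4)%N b5) rs sr rsb.
  split; first by rewrite (cab_count b5 rs sr rsb rf) !lez_nat c1.
  case=> // n _; rewrite (complexity_reduced sqb b5 rs sr rsb aE).
  set c := count _ _ in c1 c2 *; have := odd_double_half (b - 1); nia.
have b1 : (1 < b)%N by exact: leq_trans b5.
have b0 : 0 < b%:R :> R by rewrite ltr0n ltnW.
have b5R : 5 <= b%:R :> R by rewrite ler_nat.
have notpow (a : R) r s (k : int) : (s < r)%N -> (r < s * b)%N -> coprime r s ->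
    a = r%:R / s%:R * b%:R ^ k -> forall h : int, a <> b%:R ^ h.
  move=> sr rsb rs aE h; rewrite -[a]expr1.
  exact: (reduced_indep sqb b5 rs sr rsb aE).
split.
- have rs : coprime b.+1 b by rewrite coprime_sym coprimenS.
  have sr : (b < b.+1)%N by [].
  have rsb : (b.+1 < b * b)%N by nia.
  have aE : b%:R + 1 = b.+1%:R / b%:R * b%:R ^ 1 :> R.
    by rewrite expr1z divfK ?gt_eqF // natr1.
  have rf : is_reduced_form (b%:R + 1 : R) b (b.+1, b).
    split=> //=; last by exists 1.
      by rewrite ltr_pdivlMr // mul1r ltr_nat.
    by rewrite ltr_pdivrMr // -natrM ltr_nat.
  have cE : count (predC (inherited b b.+1 b)) (iota 1 b.-1) = (b - 1)%N.
    have := count_predC (inherited b b.+1 b) (iota 1 b.-1).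
    rewrite count_inherited // size_iota.
    have -> : gcdn b b.+1 = 1%N by apply/eqP; exact: coprimenS.
    by rewrite divn_small ?div0n //; lia.
  split.
  + split=> //; first by lra.
      by exists b.+1%:R => //; rewrite rmorph_nat natr1.
    exact: (notpow _ _ _ _ sr rsb rs aE).
  + by rewrite (cab_count b5 rs sr rsb rf) cE.
  + case=> // n _; rewrite (complexity_reduced sqb b5 rs sr rsb aE) cE; nia.
- have rs : coprime 2 1 by [].
  have sr : (1 < 2)%N by [].
  have rsb : (2 < 1 * b)%N by rewrite mul1n (leq_trans _ b5).
  have aE : 2 = 2%:R / 1%:R * b%:R ^ 0 :> R by rewrite expr0z mulr1 divr1.
  have rf : is_reduced_form (2 : R) b (2, 1)%N.
    by split=> //=; [lra | lra | exists 0].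
  have cE : count (predC (inherited b 2 1)) (iota 1 b.-1) = (b - 1)./2.
    have := count_predC (inherited b 2 1) (iota 1 b.-1).
    rewrite count_inherited // size_iota divn1.
    have -> : gcdn b 2 = (~~ odd b).+1.
      rewrite gcdnC; case: (boolP (odd b)) => ob /=.
        by apply/eqP; rewrite -/(coprime 2 b) coprime2n.
      by apply/gcdn_idPl; rewrite dvdn2.
    have := odd_double_half b; have := odd_double_half b.-1; lia.
  split.
  + split=> //.
      by exists 2%:R => //; rewrite rmorph_nat.
    exact: (notpow _ _ _ _ sr rsb rs aE).
  + by rewrite (cab_count b5 rs sr rsb rf) cE.
  + case=> // n _; rewrite (complexity_reduced sqb b5 rs sr rsb aE) cE.
    have := odd_double_half (b - 1); nia.
Qed.
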